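(* Let $K=\{123,132,312\}$ and let $f(n)$ be the number of equivalence classes of $S_n$ under $K$-equivalence. Then $f(3)=4$, $f(4)=9$, and for all integers $n\ge 5$, $$f(n)=f(n-1)+(n-2)\cdot f(n-2)+1.$$
   Context: Permutations in $S_n$ are written as words $\pi_1\pi_2\cdots\pi_n$ in one-line notation. The order permutation of a word $u$ of $c$ distinct positive integers is the unique $\sigma\in S_c$ with $\sigma_i<\sigma_j$ iff $u_i<u_j$. A replacement partition $K$ of $S_c$ is a set partition of $S_c$; it is denoted by listing its parts with the one-element parts (and outer brackets) omitted, so here $K$ is the set partition of $S_3$ whose only part of size greater than one is $\{123,132,312\}$. The $K$-equivalence on $S_n$ is the equivalence relation generated by: $\phi\equiv\psi$ whenever $\phi=aub$ and $\psi=avb$ (concatenations) for some possibly empty words $a,b$ and words $u,v$ of length $c$ (so $u,v$ occupy the same $c$ consecutive positions) such that the order permutations of $u$ and $v$ lie in the same part of $K$. All equivalence classes are counted, including one-element classes. *)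

(* Defs.v *)
From Stdlib Require Import Relation_Operators.
From mathcomp Require Import all_boot all_fingroup.
From mathcomp Require Import boolp.

Set Implicit Arguments.
Unset Strict Implicit.
Unset Printing Implicit Defensive.

(* 'S_n permutes {0, ..., n-1}; letters are shifted by one so that the words
   use the letters 1, ..., n. *)
Definition one_line n (s : 'S_n) : seq nat := [seq (s i).+1 | i <- enum 'I_n].

(* At most one s satisfies this for a given u, and exactly one does when u has
   c distinct letters. *)
Definition is_order_perm c (u : seq nat) (s : 'S_c) : Prop :=
  size u = c /\ forall i j : 'I_c, (s i < s j) = (nth 0 u i < nth 0 u j).

Definition replacement_step c (K : {set {set 'S_c}}) n (phi psi : 'S_n) : Prop :=
  exists a b u v : seq nat,
    [/\ one_line phi = a ++ u ++ b,
        one_line psi = a ++ v ++ b,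
        size u = c,
        size v = c
      & exists2 B : {set 'S_c}, B \in K &
          exists s t : 'S_c,
            [/\ s \in B, t \in B, is_order_perm u s & is_order_perm v t]].

Definition K_equiv c (K : {set {set 'S_c}}) n : 'S_n -> 'S_n -> Prop :=
  clos_refl_sym_trans 'S_n (@replacement_step c K n).

Definition num_classes c (K : {set {set 'S_c}}) n : nat :=
  #|equivalence_partition (fun phi psi : 'S_n => `[< K_equiv K phi psi >])
      [set: 'S_n]|.

Definition add_singletons (T : finType) (Q : {set {set T}}) : {set {set T}} :=
  Q :|: [set [set x] | x in ~: cover Q].

Definition perms_of_words c (ws : seq (seq nat)) : {set 'S_c} :=
  [set s : 'S_c | one_line s \in ws].

Definition K_123_132_312 : {set {set 'S_3}} :=
  add_singletons
    [set perms_of_words 3 [:: [:: 1; 2; 3]; [:: 1; 3; 2]; [:: 3; 1; 2]]].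

(* Main.v *)
Require Import Defs.
From mathcomp Require Import all_boot all_fingroup.
From Stdlib Require Import Relation_Operators.
From mathcomp Require Import boolp zify.

(** The moves exchange the patterns xyz, xzy and zxy on consecutive letters
    x < y < z. The classes of the words on a sorted alphabet x < y < ... are
    described by what follows the smallest letter x.

    The key fact ([weq_tail]) is that a letter followed only by larger letters
    lets them be rearranged arbitrarily. Hence, if the letters after x have
    minimum m, then m can be put right after x, and x then travels leftwards
    over any z > m ([weq_front]), or rightwards until only m follows it.

    Conversely, for every bound c, the truth of the statement that all letters
    after x are at least c is preserved by the moves ([all_leq_after_weq]);
    so the minimum m of the letters after x is an invariant of the class, and so
    is the fact that x comes last. This gives three kinds of classes of words
    with n letters.
    - x is last: deleting x leaves a word on n-1 letters whose class is an
      invariant ([weq_filter_last]), so there are f(n-1) such classes.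
    - m = y: all these words are equivalent to the sorted word, by [weq_front],
      so there is one such class.
    - m > y: the word is equivalent to v x m, where v is the word with x and m
      deleted, and the class of v is an invariant ([weq_filter_pair]). Indeed a
      move that touches x or m takes place to the right of all the letters below
      m other than x; the last of these survives the deletion and lets all the
      letters after it be rearranged. With n-2 choices of m, this makes
      (n-2) f(n-2) classes.

    The recursion holds for all n >= 2 with f(0) = f(1) = 1. It is turned into
    an explicit list of class representatives ([reps], [reps_transversal]). *)

Set Implicit Arguments.
Unset Strict Implicit.
Unset Printing Implicit Defensive.

(** * Equivalence of words *)

(** The two generating moves on words, for letters x < y < z in consecutive
    positions: xyz to xzy and xzy to zxy. *)
Inductive wstep : seq nat -> seq nat -> Prop :=
| WStep123 a b x y z of x < y & y < z :
    wstep (a ++ [:: x, y, z & b]) (a ++ [:: x, z, y & b])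
| WStep132 a b x y z of x < y & y < z :
    wstep (a ++ [:: x, z, y & b]) (a ++ [:: z, x, y & b]).

(** Equivalence of words of natural numbers: the closure of [wstep]. *)
Definition weq : seq nat -> seq nat -> Prop := clos_refl_sym_trans _ wstep.

Lemma weq_refl w : weq w w. Proof. exact: rst_refl. Qed.
Lemma weq_sym w w' : weq w w' -> weq w' w. Proof. exact: rst_sym. Qed.
Lemma weq_trans w2 w1 w3 : weq w1 w2 -> weq w2 w3 -> weq w1 w3.
Proof. exact: rst_trans. Qed.
#[local] Hint Resolve weq_refl : core.

(** A property E of the images by f, proved for one move out of a word
    satisfying I, holds for equivalent words when E is an equivalence relation
    and I is preserved by the moves in both directions. *)
Lemma weq_transport (T : Type) (E : T -> T -> Prop) (f : seq nat -> T)
    (I : seq nat -> Prop) :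
    (forall u, E u u) -> (forall u v, E u v -> E v u) ->
    (forall u v w, E u v -> E v w -> E u w) ->
    (forall w w', wstep w w' -> (I w <-> I w')) ->
    (forall w w', wstep w w' -> I w -> E (f w) (f w')) ->
  forall w w', weq w w' -> I w -> E (f w) (f w').
Proof.
move=> Er Es Et stepI stepE w w' ww'.
suff: (I w <-> I w') /\ (I w -> E (f w) (f w')) by case.
elim: ww' => {w w'} [w w' st|w|w w' _ [ww' Eww']|w1 w2 w3 _ [I12 E12] _ [I23 E23]].
- by split; [exact: stepI | exact: stepE].
- by split.
- by split; [rewrite ww' | move=> /ww' /Eww' /Es].
- split; first by rewrite I12.
  move=> I1; apply: Et (E12 I1) (E23 _); exact/I12.
Qed.

Lemma weq_cat a b w w' : weq w w' -> weq (a ++ w ++ b) (a ++ w' ++ b).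
Proof.
move=> ww'; apply: (@weq_transport _ weq (fun v => a ++ v ++ b) xpredT) ww' _ => //.
- exact: weq_sym.
- by move=> u v t; exact: weq_trans.
- move=> _ _ [] c d x y z xy yz _; rewrite -!catA !(catA a c) /=; apply: rst_step.
    exact: WStep123.
  exact: WStep132.
Qed.

Lemma weq_catl a w w' : weq w w' -> weq (a ++ w) (a ++ w').
Proof. by move/(weq_cat a [::]); rewrite !cats0. Qed.

Lemma weq_catr b w w' : weq w w' -> weq (w ++ b) (w' ++ b).
Proof. exact: (weq_cat [::] b). Qed.

Lemma weq_cons x w w' : weq w w' -> weq (x :: w) (x :: w').
Proof. exact: (@weq_catl [:: x]). Qed.

Lemma wstep_perm w w' : wstep w w' -> perm_eq w w'.
Proof.
case=> a b x y z _ _; rewrite perm_cat2l.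
  by rewrite perm_cons (perm_catCA [:: y] [:: z]).
by rewrite (perm_catCA [:: x] [:: z]).
Qed.

Lemma weq_perm w w' : weq w w' -> perm_eq w w'.
Proof.
move=> ww'; apply: (@weq_transport _ perm_eq id xpredT) ww' _ => //.
- by move=> u v; rewrite perm_sym.
- by move=> u v t; exact: perm_trans.
- by move=> u v /wstep_perm.
Qed.

Lemma weq_swap_after x y z b : x < y -> x < z ->
  weq [:: x, y, z & b] [:: x, z, y & b].
Proof.
move=> xy xz; case: (ltngtP y z) => [yz|zy|->//].
  exact/rst_step/(@WStep123 [::]).
exact/weq_sym/rst_step/(@WStep123 [::]).
Qed.

Lemma weq_jump x y z b : x < y -> y < z -> weq [:: x, z, y & b] [:: z, x, y & b].
Proof. by move=> xy yz; exact/rst_step/(@WStep132 [::]). Qed.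

(** * Rearranging the letters that follow a smaller letter *)

Lemma seq_min (u : seq nat) : u != [::] -> exists2 m, m \in u & all (leq m) u.
Proof.
elim: u => // x [_ _|y u /(_ isT)[m mu um] _].
  by exists x; rewrite ?mem_head //= leqnn.
case: (leqP x m) => [xm|mx].
  exists x; rewrite ?mem_head // [all _ _]/= leqnn.
  by apply: sub_all um => c; exact: leq_trans.
by exists m; [rewrite inE mu orbT | rewrite [all _ _]/= ltnW].
Qed.

(** Induction step of [weq_tail]: the least letter m following x can be brought
    next to x. If m is not the last letter, only the letters before the last are
    rearranged; otherwise x jumps over a letter hi and the shorter tail behind
    the new position of x is rearranged. *)
Lemma weq_min_front n x u m :
    (forall y v v', size v <= n -> uniq v -> all (ltn y) v -> perm_eq v v' ->
       weq (y :: v) (y :: v')) ->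
    size u <= n.+1 -> uniq u -> all (ltn x) u -> m \in u -> all (leq m) u ->
  exists r, weq (x :: u) [:: x, m & r].
Proof.
move=> IH; case/lastP: u => // u l; rewrite size_rcons ltnS => su.
rewrite rcons_uniq all_rcons mem_rcons inE all_rcons.
case/andP=> lu uu /andP[/= xl xu] mlu /andP[ml mu].
case: (boolP (m \in u)) => [mIu|mNu].
  exists (rcons (rem m u) l); rewrite -!rcons_cons -!cats1.
  by apply/weq_catr/IH => //; exact: perm_to_rem.
have {mlu ml} Em : m = l by move: mlu; rewrite (negPf mNu) orbF => /eqP.
have {mu} {}mu c : c \in u -> m < c.
  move=> cu; rewrite ltn_neqAle (allP mu) // andbT.
  by apply: contraNneq mNu => ->.
subst l; case: u su lu uu xu mNu mu => [|c1 [|c2 d]] su lu uu xu mNu mu.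
- by exists [::].
- by exists [:: c1]; apply: weq_swap_after => //; case/andP: xu.
have [xc1 xc2 xd] : [/\ x < c1, x < c2 & all (ltn x) d] by case/and3P: xu.
have [hi [lo [lohi /= hilo swap]]] : exists hi lo, [/\ lo < hi,
    [:: hi; lo] =i [:: c1; c2] & forall e,
    weq [:: x, c1, c2 & e] [:: x, hi, lo & e]].
  case: (ltngtP c2 c1) => [lt12|lt12|E12].
  - by exists c1, c2; split.
  - exists c2, c1; split=> // [c|e]; first by rewrite !inE orbC.
    exact: weq_swap_after.
  - by move: uu; rewrite E12 /= inE eqxx.
have [hiI loI] : hi \in [:: c1; c2] /\ lo \in [:: c1; c2].
  by rewrite -!hilo !inE !eqxx orbT.
have sub c : c \in [:: c1; c2] -> c \in [:: c1, c2 & d].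
  by rewrite !inE orbA => ->.
have xlo : x < lo := allP xu _ (sub _ loI); have mhi := mu _ (sub _ hiI).
have lod : lo \notin d.
  move: uu loI; rewrite /= !inE negb_or => /and3P[/andP[_ c1d] c2d _].
  by case/orP=> /eqP->.
have md : m \notin d by move: lu; rewrite !inE !negb_or => /and3P[].
exists [:: hi, lo & d]; rewrite /=.
apply: weq_trans (swap _) _.
(* m is brought to the front behind hi, where only size d + 2 letters follow x *)
apply: (weq_trans (weq_jump _ xlo lohi)).
apply: (@weq_trans [:: hi, x, m, lo & d]).
  apply/weq_cons/IH.
  - by rewrite /= size_rcons.
  - rewrite /= rcons_uniq mem_rcons inE negb_or lod md /=.
    move: uu; rewrite /= => /and3P[_ _ ->]; rewrite andbT.
    by rewrite gtn_eqF // mu // sub.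
  - by rewrite /= all_rcons /= xlo xl.
  - by rewrite -rcons_cons -cats1 perm_catC.
apply: weq_trans (weq_sym (weq_jump _ xl mhi)) _.
apply: weq_swap_after => //; exact: ltn_trans mhi.
Qed.

(** By induction on the size: the least letter of u can be brought next to x, and
    it is then itself followed by larger letters only. *)
Lemma weq_tail x u u' : uniq u -> all (ltn x) u -> perm_eq u u' ->
  weq (x :: u) (x :: u').
Proof.
have [n su] := ubnPleq (size u).
elim: n x u u' su => [|n IH] x u u' su uu xu puu'.
  move: su; rewrite leqn0 => /nilP Eu; move: puu'; rewrite Eu perm_sym.
  by move/perm_nilP ->.
case: (eqVneq u [::]) => [Eu|/seq_min[m mI mu]].
  by move: puu'; rewrite Eu perm_sym => /perm_nilP ->.
have [r ur] := weq_min_front IH su uu xu mI mu.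
have [r' ur'] : exists r', weq (x :: u') [:: x, m & r'].
  apply: (weq_min_front IH); first by rewrite -(perm_size puu').
  - by rewrite -(perm_uniq puu').
  - by rewrite -(perm_all _ puu').
  - by rewrite -(perm_mem puu').
  - by rewrite -(perm_all _ puu').
have pr : perm_eq u (m :: r) by rewrite -(perm_cons x); exact: weq_perm.
have pr' : perm_eq u' (m :: r') by rewrite -(perm_cons x); exact: weq_perm.
apply: weq_trans ur (weq_trans _ (weq_sym ur')); apply/weq_cons/IH.
- by move: su; rewrite (perm_size pr).
- by move: uu; rewrite (perm_uniq pr) => /andP[].
- move: uu mu; rewrite (perm_uniq pr) (perm_all _ pr) /= leqnn /=.
  case/andP=> mr _ /allP mu; apply/allP => c cr /=.
  by rewrite ltn_neqAle mu // andbT; apply: contraNneq mr => ->.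
- by rewrite -(perm_cons m) -(permPl pr) -(permPr pr').
Qed.

(** A smallest letter x can move to the front over c when some letter m after x
    is smaller than every letter of c; the other letters then come in any
    order. *)
Lemma weq_front x m c b d : uniq (c ++ b) -> all (ltn x) (c ++ b) ->
  m \in b -> all (ltn m) c -> perm_eq (c ++ b) d -> weq (c ++ x :: b) (x :: d).
Proof.
elim/last_ind: c b => [|c z IH] b /=; first by move=> *; exact: weq_tail.
rewrite cat_rcons all_rcons => ucb xcb mb /andP[/= mz mc] pd.
have [_ _ /= /andP[_ ub]] := and3P (etrans (esym (cat_uniq _ _)) ucb).
have := xcb; rewrite all_cat /= => /and3P[_ xz xb].
have pzb : perm_eq (z :: b) [:: z, m & rem m b].
  by rewrite perm_cons; exact: perm_to_rem.
have pcb := perm_cat (perm_refl c) pzb.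
rewrite cat_rcons; apply: (@weq_trans (c ++ [:: x, z, m & rem m b])).
  apply: weq_catl.
  apply: weq_trans (weq_cons z (weq_tail ub xb (perm_to_rem mb))) _.
  by apply/weq_sym/weq_jump => //; exact: (allP xb).
apply: IH => //.
- by rewrite -(perm_uniq pcb).
- by rewrite -(perm_all _ pcb).
- by rewrite !inE eqxx orbT.
- by rewrite -(permPl pcb).
Qed.

(** * Invariants of the equivalence *)

(** The letters that follow the first occurrence of x in w; empty if x does not
    occur. *)
Fixpoint after (x : nat) (w : seq nat) : seq nat :=
  if w is c :: w' then if c == x then w' else after x w' else [::].

Lemma after_cat x a c :
  after x (a ++ c) = if x \in a then after x a ++ c else after x c.
Proof.
elim: a => //= d a IH; rewrite inE eq_sym.
by case: eqP => //= _; rewrite IH.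
Qed.

Lemma mem_after x c w : c \in after x w -> c \in w.
Proof.
elim: w => //= d w IH; rewrite inE; case: eqP => _ cw; first by rewrite cw orbT.
by rewrite IH ?orbT.
Qed.

Lemma all_leq_after_step c x w w' : wstep w w' -> all (leq x) w ->
  all (leq c) (after x w) = all (leq c) (after x w').
Proof.
case=> a b x0 y0 z0 xy yz; rewrite all_cat => /andP[_ /and4P[xx0 _ _ _]];
  rewrite !after_cat; case: ifP => _; rewrite ?all_cat /=.
- by rewrite (andbCA (c <= y0)).
- rewrite (gtn_eqF (leq_ltn_trans xx0 xy)).
  rewrite (gtn_eqF (leq_ltn_trans xx0 (ltn_trans xy yz))).
  by case: eqP => //= _; rewrite andbCA.
- by rewrite (andbCA (c <= x0)).
- rewrite (gtn_eqF (leq_ltn_trans xx0 xy)).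
  rewrite (gtn_eqF (leq_ltn_trans xx0 (ltn_trans xy yz))).
  case: eqP => //= _; case cy: (c <= y0); last by rewrite andbF.
  by rewrite (leq_trans cy (ltnW yz)).
Qed.

(** When x is the least letter, the minimum of the letters after x is an
    invariant, expressed through its lower bounds c; x is last exactly when
    every c is a lower bound. *)
Lemma all_leq_after_weq c x w w' : weq w w' -> all (leq x) w ->
  all (leq c) (after x w) = all (leq c) (after x w').
Proof.
move=> ww' xw.
apply: (@weq_transport _ eq (fun w => all (leq c) (after x w)) (all (leq x)))
  ww' xw => //.
- by move=> u v t ->.
- by move=> u v /wstep_perm p; rewrite (perm_all _ p).
- by move=> u v; exact: all_leq_after_step.
Qed.

Lemma wstep_filter_keep (P : pred nat) a b x y z : x < y -> y < z ->
  P x -> P y -> P z ->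
  weq (filter P (a ++ [:: x, y, z & b])) (filter P (a ++ [:: x, z, y & b])) /\
  weq (filter P (a ++ [:: x, z, y & b])) (filter P (a ++ [:: z, x, y & b])).
Proof.
move=> xy yz Px Py Pz; rewrite !filter_cat /= Px Py Pz; split.
  exact/rst_step/WStep123.
exact/rst_step/WStep132.
Qed.

(** A least letter x in last position takes part in no move, so the class of the
    rest of the word is an invariant. *)
Lemma weq_filter_last x w w' : weq w w' -> all (leq x) w -> after x w = [::] ->
  weq (filter (predC1 x) w) (filter (predC1 x) w').
Proof.
move=> ww' xw aw.
(* after x w is empty iff every c is a lower bound of it *)
pose I w := all (leq x) w /\ forall c, all (leq c) (after x w).
apply: (@weq_transport _ weq (filter (predC1 x)) I) ww' _ => //.
- exact: weq_sym.
- by move=> u v t; exact: weq_trans.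
- move=> u v st; rewrite /I (perm_all _ (wstep_perm st)); split.
    case=> xv uc; split=> // c; rewrite -(all_leq_after_step _ st) //.
    by rewrite (perm_all _ (wstep_perm st)).
  case=> xv uc; split=> // c; rewrite (all_leq_after_step _ st) //.
  by rewrite (perm_all _ (wstep_perm st)).
- move=> _ _ [] a b x0 y0 z0 xy yz [];
    rewrite all_cat => /andP[_ /and4P[xx0 _ _ _]] /(_ (maxn y0 z0).+1);
    rewrite after_cat; (case: ifP => _; [rewrite all_cat /=; lia | move=> /=]);
    (case: eqP => [_ /=|/eqP x0x _]; first by lia);
    case: (@wstep_filter_keep (predC1 x) a b x0 y0 z0) => //=;
    by rewrite gtn_eqF //; lia.
- by split=> // c; rewrite aw.
Qed.

Lemma split_last_has (P : pred nat) s : has P s ->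
  exists a p b, [/\ s = a ++ p :: b, P p & ~~ has P b].
Proof.
elim: s => //= c s IH; case: (boolP (has P s)) => [/IH[a [p [b [-> Pp Pb]]]] _|Ps].
  by exists (c :: a), p, b.
by rewrite orbF => Pc; exists [::], c, s.
Qed.

(** Rearranging a factor u does not change the class of the subword of letters
    satisfying P, if that subword has, before u, a letter less than m, while its
    letters in u and after u are at least m: the last letter less than m is
    followed in the subword by larger letters only. *)
Lemma weq_filter_tail (P : pred nat) m y a u u' b :
    uniq (a ++ u ++ b) -> perm_eq u u' -> y \in a -> P y -> y < m ->
    (forall c, c \in u ++ b -> P c -> m <= c) ->
  weq (filter P (a ++ u ++ b)) (filter P (a ++ u' ++ b)).
Proof.
move=> uw uu' ya Py ym Pm.
have /split_last_has[a0 [p [a1 [Ea pm a1m]]]] : has (ltn^~ m) (filter P a).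
  by apply/hasP; exists y; rewrite // mem_filter Py.
have Ew v : filter P (a ++ v ++ b) = a0 ++ p :: (a1 ++ filter P v ++ filter P b).
  by rewrite !filter_cat Ea -catA.
have := filter_uniq P uw; rewrite !Ew => {}uw; apply/weq_catl/weq_tail.
- by move: uw; rewrite cat_uniq => /and3P[_ _ /andP[]].
- rewrite all_cat -filter_cat; apply/andP; split; apply/allP => c /=.
    by move=> ca1; apply: leq_trans pm _; rewrite leqNgt (hasPn a1m).
  by rewrite mem_filter => /andP[Pc /Pm /(_ Pc)]; exact: leq_trans.
- by rewrite perm_cat2l perm_cat2r perm_filter.
Qed.

(** When the least letter is x and the letters after x have minimum m, with m
    not the second smallest letter, deleting x and m yields a word whose class
    is an invariant. The hypotheses on [after] say that m is this minimum. *)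
Lemma weq_filter_pair x m y w w' : weq w w' -> uniq w -> all (leq x) w ->
    y \in w -> x < y < m ->
    all (leq m) (after x w) -> ~~ all (leq m.+1) (after x w) ->
  weq (filter [pred c | (c != x) && (c != m)] w)
      (filter [pred c | (c != x) && (c != m)] w').
Proof.
move=> ww' uw xw yw /andP[xy ym] mw mw'; set P := [pred c | _].
pose I w := [/\ uniq w, all (leq x) w, y \in w,
  all (leq m) (after x w) & ~~ all (leq m.+1) (after x w)].
apply: (@weq_transport _ weq (filter P) I) ww' _ => //.
- exact: weq_sym.
- by move=> u v t; exact: weq_trans.
- move=> u v st; have p := wstep_perm st.
  rewrite /I (perm_uniq p) (perm_mem p) (perm_all _ p); split.
    by case=> uv xv yv mv mv'; rewrite -!(all_leq_after_step _ st) ?(perm_all _ p).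
  by case=> uv xv yv mv mv'; rewrite !(all_leq_after_step _ st) ?(perm_all _ p).
(* A move either keeps all its letters, or touches x or m, and then the letters
   of u and b other than x are all at least m. *)
have key a u u' b : I (a ++ u ++ b) -> perm_eq u u' ->
    (x \in u -> exists v, u = x :: v) ->
    all P u \/ weq (filter P (a ++ u ++ b)) (filter P (a ++ u' ++ b)).
  case=> {uw xw yw mw mw'}; set w0 := a ++ _ => uw xw yw mw mw' puu' xu.
  case: (boolP (all P u)) => [uP|nP]; [by left | right].
  have ub c : c \in u ++ b -> P c -> m <= c.
    move: mw mw'; rewrite /w0 after_cat; case: ifP => [_|xa].
      by rewrite all_cat => /andP[_ /allP mub] _ /mub.
    case xIu: (x \in u).
      have [v ->] := xu xIu; rewrite /= eqxx => /allP mvb _; rewrite inE.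
      by case/orP=> [/eqP->|/mvb]; rewrite ?eqxx.
    rewrite after_cat xIu => mb /allPn[m' m'b]; rewrite -ltnNge ltnS => m'm.
    have Em : m' = m by apply/eqP; rewrite eqn_leq m'm (allP mb).
    case/allPn: nP => d du; rewrite /= negb_and !negbK.
    case/orP=> /eqP Ed; first by rewrite -Ed du in xIu.
    move: uw; rewrite /w0 catA cat_uniq => /and3P[_ /hasPn/(_ m) + _].
    rewrite -{1}Em => /(_ (mem_after m'b)) /=.
    by rewrite mem_cat -Ed du orbT.
  have Py : P y by rewrite /= gtn_eqF // ltn_eqF.
  apply: (weq_filter_tail uw puu' _ Py ym ub).
  have := yw; rewrite /w0 mem_cat; case/orP=> // /ub/(_ Py).
  by rewrite leqNgt ym.
move=> _ _ [] a b x0 y0 z0 xy0 yz0 Iw.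
- case: (key a [:: x0; y0; z0] [:: x0; z0; y0] b) => //.
  + by rewrite perm_cons (perm_catC [:: y0] [:: z0]).
  + case: Iw => _ + _ _ _; rewrite all_cat => /andP[_ /and4P[xx0 _ _ _]].
    rewrite !inE; case: eqP => [-> _|_ /=]; first by eexists.
    by lia.
  + by case/and4P=> Px Py Pz _; case: (@wstep_filter_keep P a b x0 y0 z0).
- case: (key a [:: x0; z0; y0] [:: z0; x0; y0] b) => //.
  + by rewrite (perm_catCA [:: x0] [:: z0]).
  + case: Iw => _ + _ _ _; rewrite all_cat => /andP[_ /and4P[xx0 _ _ _]].
    rewrite !inE; case: eqP => [-> _|_ /=]; first by eexists.
    by lia.
  + by case/and4P=> Px Py Pz _; case: (@wstep_filter_keep P a b x0 y0 z0).
Qed.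

(** * Representatives of the classes *)

(** Class representatives for the words on the sorted alphabet s; any k at
    least [size s] serves as recursion bound. On the alphabet x < y < ... they
    are the sorted word, the words r x, and the words r x m with m > y, where r
    represents a class on the remaining letters. *)
Fixpoint reps (k : nat) (s : seq nat) : seq (seq nat) :=
  match k, s with
  | k'.+1, [:: x, y & t] =>
      s :: [seq rcons r x | r <- reps k' (y :: t)] ++
        [seq r ++ [:: x; m] | m <- t, r <- reps k' (y :: rem m t)]
  | _, _ => [:: s]
  end.

(** The solution of the recursion with f(0) = f(1) = 1. *)
Fixpoint class_count (n : nat) : nat :=
  match n with
  | n1.+1 =>
      match n1 with
      | n2.+1 => class_count n1 + n2 * class_count n2 + 1
      | 0 => 1
      end
  | 0 => 1
  end.

Arguments class_count : simpl never.

(** R lists, without repetition, exactly one word of each equivalence class of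
    the words on the alphabet s. *)
Record transversal (s : seq nat) (R : seq (seq nat)) : Prop := Transversal {
  trans_perm : forall r, r \in R -> perm_eq r s;
  trans_ex : forall w, perm_eq w s -> exists2 r, r \in R & weq w r;
  trans_inj : forall r r', r \in R -> r' \in R -> weq r r' -> r = r';
  trans_uniq : uniq R
}.

Lemma class_countE n :
  class_count n.+2 = class_count n.+1 + n * class_count n + 1.
Proof. by []. Qed.

Lemma size_reps k s : size s <= k -> size (reps k s) = class_count (size s).
Proof.
elim: k s => [|k IH] [|x [|y t]] //= st.
rewrite class_countE addn1 size_cat size_map IH // size_allpairs_dep.
set N := class_count (size t).
have /eq_in_map-> : {in t, (fun m => size (reps k (y :: rem m t))) =1 fun=> N}.
  move=> m mt; have t0 : 0 < size t by case: (t) mt.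
  by rewrite IH /= size_rem ?prednK //; exact: ltnW.
have -> : sumn [seq N | _ <- t] = size t * N by elim: (t) => //= _ v ->.
by [].
Qed.

Lemma transversal1 s : size s <= 1 -> transversal s [:: s].
Proof.
move=> s1; split=> [r|w ws|r r'|] //.
- by rewrite inE => /eqP->.
- by exists s; rewrite ?mem_head // (perm_small_eq s1 ws).
- by rewrite !inE => /eqP-> /eqP->.
Qed.

(** The recursive step: transversals for the alphabets without x, and without x
    and m, give one for the whole alphabet. *)
Section TransversalStep.

Variables (x y : nat) (t : seq nat) (R1 : seq (seq nat)).
Variable R2 : nat -> seq (seq nat).

Hypothesis xyt : sorted ltn [:: x, y & t].
Hypothesis R1_trans : transversal (y :: t) R1.
Hypothesis R2_trans : forall m, m \in t -> transversal (y :: rem m t) (R2 m).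

Let s := [:: x, y & t].
Let Rlast := [seq rcons r x | r <- R1].
Let Rpair := [seq r ++ [:: x; m] | m <- t, r <- R2 m].
Let R := s :: Rlast ++ Rpair.

Let x_lt_y : x < y. Proof. by case/andP: xyt. Qed.
Let y_lt : all (ltn y) t.
Proof. by case/andP: xyt => _; exact: (order_path_min ltn_trans). Qed.
Let x_lt : all (ltn x) t.
Proof. by apply: sub_all y_lt => c; exact: ltn_trans. Qed.
Let uniq_s : uniq s.
Proof. by apply: sorted_uniq xyt; [exact: ltn_trans | exact: ltnn]. Qed.

Let R1_xfree r : r \in R1 -> x \notin r.
Proof.
by move/(trans_perm R1_trans)/perm_mem->; case/andP: uniq_s.
Qed.

Let R2_free m r : m \in t -> r \in R2 m -> x \notin r /\ m \notin r.
Proof.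
move=> mt rR; have/perm_mem r_mem := trans_perm (R2_trans mt) rR.
have yt : y \notin t by case/and3P: uniq_s.
have ut : uniq t by case/and3P: uniq_s.
split; rewrite r_mem inE; apply/norP; split.
- by rewrite ltn_eqF.
- by apply/negP => /mem_rem /(allP x_lt) /=; rewrite ltnn.
- by apply: contraNneq yt => <-.
- by rewrite mem_rem_uniqF.
Qed.

Let R_perm r : r \in R -> perm_eq r s.
Proof.
rewrite inE mem_cat => /or3P[/eqP->|/mapP[r1 r1R ->]|].
- exact: perm_refl.
- by rewrite perm_rcons perm_cons; exact: (trans_perm R1_trans).
case/allpairsPdep => m [r2 [mt r2R ->]].
rewrite perm_catC /= perm_cons perm_sym.
apply: perm_trans (_ : perm_eq _ [:: y, m & rem m t]) _.
  by rewrite perm_cons; exact: perm_to_rem.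
rewrite (perm_catCA [:: y] [:: m]) perm_cons perm_sym.
exact: trans_perm (R2_trans mt) _ r2R.
Qed.

Let R_geq r : r \in R -> all (leq x) r.
Proof.
move/R_perm/perm_all->; rewrite /= leqnn ltnW //=.
by apply: sub_all x_lt => c; exact: ltnW.
Qed.

Let R_ex w : perm_eq w s -> exists2 r, r \in R & weq w r.
Proof.
move=> ws; have xw : x \in w by rewrite (perm_mem ws) mem_head.
case/splitPr: xw ws => a b ws.
have pab : perm_eq (a ++ b) (y :: t).
  by rewrite -(perm_cons x) -(permPr ws) (perm_catCA [:: x] a).
have uab : uniq (a ++ b) by rewrite (perm_uniq pab); case/andP: uniq_s.
have xab : all (ltn x) (a ++ b) by rewrite (perm_all _ pab) /= x_lt_y x_lt.
have [Eb|/seq_min[m mb bm]] := eqVneq b [::].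
  move: pab; rewrite Eb cats0 => /(trans_ex R1_trans)[r rR ar].
  exists (rcons r x); last by rewrite -cats1; exact: weq_catr.
  by rewrite inE mem_cat; apply/or3P/Or32/mapP; exists r.
(* m is the least letter after x: it is y, or it belongs to t *)
have : m \in y :: t by rewrite -(perm_mem pab) mem_cat mb orbT.
rewrite inE => /orP[/eqP Em|mt].
  exists s; rewrite ?mem_head //.
  apply: (@weq_front x y) => //; rewrite -?Em //.
  apply/allP => c ca /=; rewrite Em.
  have : c \in y :: t by rewrite -(perm_mem pab) mem_cat ca.
  rewrite inE => /orP[/eqP Ec|/(allP y_lt) //].
  move: uab; rewrite cat_uniq => /and3P[_ /hasPn/(_ m mb) + _].
  by rewrite /= Em -Ec ca.
have ub : uniq b by move: uab; rewrite cat_uniq => /and3P[].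
have prem : perm_eq (rem m b ++ [:: m]) b.
  by rewrite perm_catC perm_sym; exact: perm_to_rem.
have [r rR ar] : exists2 r, r \in R2 m & weq (a ++ rem m b) r.
  apply: (trans_ex (R2_trans mt)); rewrite -(perm_cons m).
  apply: (@perm_trans _ (a ++ b)).
    by rewrite -(perm_catCA a [:: m]) perm_cat2l perm_sym perm_to_rem.
  apply: (perm_trans pab); apply: (@perm_trans _ [:: y, m & rem m t]).
    by rewrite perm_cons; exact: perm_to_rem.
  by rewrite (perm_catCA [:: y] [:: m]).
exists (r ++ [:: x; m]).
  rewrite inE mem_cat; apply/or3P/Or33/allpairsPdep; by exists m, r.
(* rem m b ++ [:: x; m] is equivalent to x :: b, as m is less than all of rem m b *)
apply: (@weq_trans ((a ++ rem m b) ++ [:: x; m])); last exact: weq_catr.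
rewrite -catA; apply: weq_catl; apply: weq_sym.
apply: (@weq_front x m) => //.
- by rewrite (perm_uniq prem).
- by rewrite (perm_all _ prem); move: xab; rewrite all_cat => /andP[].
- exact: mem_head.
- apply/allP => c cb /=; rewrite ltn_neqAle (allP bm) ?(mem_rem cb) // andbT.
  by apply: contraTneq cb => <-; rewrite mem_rem_uniqF.
Qed.

Let after_s : after x s = y :: t. Proof. by rewrite /= eqxx. Qed.

Let after_last r : r \in R1 -> after x (rcons r x) = [::].
Proof.
by move/R1_xfree/negPf => xr; rewrite -cats1 after_cat xr /= eqxx.
Qed.

Let after_pair m r : m \in t -> r \in R2 m -> after x (r ++ [:: x; m]) = [:: m].
Proof.
by move=> mt /(R2_free mt)[/negPf xr _]; rewrite after_cat xr /= eqxx.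
Qed.

Let filter_last r : r \in R1 -> filter (predC1 x) (rcons r x) = r.
Proof.
move/R1_xfree => xr; rewrite filter_rcons /= eqxx; apply/all_filterP/allP => c cr.
by apply: contraNneq xr => <-.
Qed.

Let filter_pair m r : m \in t -> r \in R2 m ->
  filter [pred c | (c != x) && (c != m)] (r ++ [:: x; m]) = r.
Proof.
move=> mt /(R2_free mt)[xr mr].
rewrite filter_cat /= !eqxx andbF /= cats0; apply/all_filterP/allP => c cr /=.
by apply/andP; split; [apply: contraNneq xr | apply: contraNneq mr] => <-.
Qed.

(** The lower bound y+1 fails for the letters after x in s only, and m+1
    separates r x m from the words with x last; for two words of the third kind,
    the bounds m and m' give m = m'. *)
Let R_inj r r' : r \in R -> r' \in R -> weq r r' -> r = r'.
Proof.
have lty m : m \in t -> y < m by move=> mt; exact: (allP y_lt).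
move=> rR r'R rr'; have := fun c => all_leq_after_weq c rr' (R_geq rR).
have := rR; have := r'R; rewrite !(inE, mem_cat).
case/or3P=> [/eqP Er'|/mapP[r1' r1R' Er']|/allpairsPdep[m' [r2' [mt' r2R' Er']]]];
  case/or3P=> [/eqP Er|/mapP[r1 r1R Er]|/allpairsPdep[m [r2 [mt r2R Er]]]];
  rewrite Er Er' ?after_s ?after_last ?after_pair //= => same.
- by have := same y.+1; rewrite ltnn.
- by have := same y.+1; rewrite ltnn andbT lty.
- by have := same y.+1; rewrite ltnn.
- have := weq_filter_last rr' (R_geq rR).
  rewrite Er Er' after_last // !filter_last // => /(_ erefl) r11'.
  by rewrite (trans_inj R1_trans r1R r1R' r11').
- by have := same m.+1; rewrite ltnn.
- by have := same y.+1; rewrite ltnn andbT lty.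
- by have := same m'.+1; rewrite ltnn.
- have Em : m' = m.
    have := same m; have := same m'; rewrite !andbT !leqnn => m'm mm'.
    by apply/eqP; rewrite eqn_leq m'm -mm'.
  have ur : uniq r by rewrite (perm_uniq (R_perm rR)).
  have yr : y \in r by rewrite (perm_mem (R_perm rR)) !inE eqxx orbT.
  have xym : x < y < m by rewrite x_lt_y lty.
  have := weq_filter_pair rr' ur (R_geq rR) yr xym.
  move: r2R' mt'; rewrite Er Er' {}Em => r2R' mt'.
  rewrite after_pair //= leqnn ltnn !filter_pair // => /(_ isT isT) r22'.
  by rewrite (trans_inj (R2_trans mt) r2R r2R' r22').
Qed.

Let R_uniq : uniq R.
Proof.
rewrite /= mem_cat cat_uniq; apply/and4P; split.
- apply/norP; split; apply/negP.
    by case/mapP => r rR Es; have := after_last rR; rewrite -Es after_s.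
  case/allpairsPdep => m [r [mt rR Es]]; have := after_pair mt rR.
  by rewrite -Es after_s => -[Em _]; have := allP y_lt _ mt; rewrite /= Em ltnn.
- rewrite map_inj_in_uniq; first exact: (trans_uniq R1_trans).
  by move=> r r' _ _ /rcons_inj[].
- apply/hasPn => _ /allpairsPdep[m [r [mt rR ->]]]; apply/negP.
  by case/mapP => r' r'R Er; have := after_last r'R; rewrite -Er after_pair.
- apply: allpairs_uniq_dep; first by case/and3P: uniq_s.
    by move=> m mt; exact: trans_uniq (R2_trans mt).
  case=> [m r] [m' r'] _ _; rewrite /= -!cat_rcons !cats0.
  by case/rcons_inj => /rcons_inj[-> ->].
Qed.

Lemma transversal_step : transversal s R.
Proof. split; [exact: R_perm|exact: R_ex|exact: R_inj|exact: R_uniq]. Qed.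

End TransversalStep.

Lemma reps_transversal k s : size s <= k -> sorted ltn s ->
  transversal s (reps k s).
Proof.
elim: k s => [|k IH] [|x [|y t]] // sk ss; try exact: transversal1.
apply: transversal_step => // [|m mt]; first by apply: IH => //=; case/andP: ss.
have t0 : 0 < size t by case: (t) mt.
apply: IH; first by rewrite /= size_rem // prednK // ltnW.
have {ss} : path ltn y t by case/andP: ss.
rewrite /= !(path_sortedE ltn_trans) => /andP[yt st].
apply/andP; split; last exact: (subseq_sorted ltn_trans (rem_subseq _ _)).
by apply/allP => c /mem_rem /(allP yt).
Qed.

(** * Permutations and their one-line words *)

Section OneLine.

Variable n : nat.

Lemma size_one_line (s : 'S_n) : size (one_line s) = n.
Proof. by rewrite size_map -cardE card_ord. Qed.

Lemma nth_one_line (s : 'S_n) (i : 'I_n) : nth 0 (one_line s) i = (s i).+1.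
Proof.
by rewrite (nth_map i) ?nth_ord_enum // -cardE card_ord.
Qed.

Lemma one_line_inj : injective (@one_line n).
Proof.
move=> s t st; apply/permP => i; apply: val_inj; apply: succn_inj.
by rewrite /= -!nth_one_line st.
Qed.

Lemma perm_one_line (s : 'S_n) : perm_eq (one_line s) (iota 1 n).
Proof.
apply: uniq_perm; rewrite ?iota_uniq //.
  by rewrite map_inj_uniq ?enum_uniq // => i j [] /val_inj /perm_inj.
apply/(uniq_min_size _ _ _).2 => [||]; rewrite ?size_one_line ?size_iota //.
  by rewrite map_inj_uniq ?enum_uniq // => i j [] /val_inj /perm_inj.
by move=> c /mapP[i _ ->]; rewrite mem_iota add1n !ltnS ltn_ord.
Qed.

Lemma one_line_surj w : perm_eq w (iota 1 n) -> exists s : 'S_n, one_line s = w.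
Proof.
move=> pw; have sw : size w = n by rewrite (perm_size pw) size_iota.
have uw : uniq w by rewrite (perm_uniq pw) iota_uniq.
have bw (i : 'I_n) : 0 < nth 0 w i <= n.
  have : nth 0 w i \in w by rewrite mem_nth ?sw.
  by rewrite (perm_mem pw) mem_iota add1n ltnS.
have lt (i : 'I_n) : (nth 0 w i).-1 < n by have := bw i; lia.
pose f i := Ordinal (lt i).
have finj : injective f.
  move=> i j [] fij; apply/val_inj/eqP; rewrite -(nth_uniq 0 _ _ uw) ?sw ?ltn_ord //.
  apply/eqP; move: (bw i) (bw j) fij => /=.
  by move=> /andP[/prednK i1 _] /andP[/prednK j1 _] ij; rewrite -i1 -j1 ij.
exists (perm finj); apply: (@eq_from_nth _ 0); rewrite size_one_line ?sw // => i ltin.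
rewrite -[i]/(val (Ordinal ltin)) nth_one_line permE /= prednK //.
by case/andP: (bw (Ordinal ltin)).
Qed.

(** The permutation with one-line word w, and the identity if there is none. *)
Definition perm_of_word (w : seq nat) : 'S_n :=
  odflt 1%g [pick s : 'S_n | one_line s == w].

Lemma perm_of_wordK w : perm_eq w (iota 1 n) -> one_line (perm_of_word w) = w.
Proof.
move/one_line_surj => [s sw]; rewrite /perm_of_word.
by case: pickP => [t /eqP //|/(_ s)]; rewrite sw eqxx.
Qed.

Lemma one_lineK : cancel (@one_line n) perm_of_word.
Proof. by move=> s; apply: one_line_inj; rewrite perm_of_wordK ?perm_one_line. Qed.

End OneLine.

(** Order permutations described through one-line words and indices in [nat]. *)
Lemma is_order_permE c (u : seq nat) (s : 'S_c) : is_order_perm u s <->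
  size u = c /\ forall i j, i < c -> j < c ->
    (nth 0 (one_line s) i < nth 0 (one_line s) j) = (nth 0 u i < nth 0 u j).
Proof.
split=> -[su ord]; split=> // i j; last first.
  by rewrite -ord // !nth_one_line ltnS.
move=> ic jc; have := ord (Ordinal ic) (Ordinal jc) => <- /=.
by rewrite -[i]/(val (Ordinal ic)) -[j]/(val (Ordinal jc)) !nth_one_line ltnS.
Qed.

Lemma size3 (u : seq nat) : size u = 3 -> exists x y z, u = [:: x; y; z].
Proof. by case: u => [|x [|y [|z []]]] // _; exists x, y, z. Qed.

(** A replacement within a one-element part of K is trivial: it keeps the order
    pattern and the set of letters, hence the word. *)
Lemma order_iso_eq3 x y z x' y' z' :
    uniq [:: x; y; z] -> perm_eq [:: x; y; z] [:: x'; y'; z'] ->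
    (x < y) = (x' < y') -> (x < z) = (x' < z') -> (y < z) = (y' < z') ->
  [:: x; y; z] = [:: x'; y'; z'].
Proof.
move=> uu puv; have vv := uu; rewrite (perm_uniq puv) in vv.
move: uu vv; rewrite /= !inE.
have := perm_mem puv x'; have := perm_mem puv y'; have := perm_mem puv z'.
rewrite !inE !eqxx !orbT => x'I y'I z'I u1 u2 xy xz yz.
by have [-> -> ->] : [/\ x = x', y = y' & z = z'] by split; lia.
Qed.

(** The one-line words of the part of K that has more than one element. *)
Definition sorting_patterns : seq (seq nat) :=
  [:: [:: 1; 2; 3]; [:: 1; 3; 2]; [:: 3; 1; 2]].

(** A factor with one of the three patterns is equivalent to its sorting. *)
Lemma order_perm_weq (u : seq nat) (s : 'S_3) :
    is_order_perm u s -> one_line s \in sorting_patterns ->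
  exists2 v, sorted ltn v & weq v u.
Proof.
case/is_order_permE=> /size3[x [y [z ->]]] ord sP.
have := ord 0 1 isT isT; have := ord 0 2 isT isT; have := ord 1 2 isT isT.
have := ord 1 0 isT isT; have := ord 2 0 isT isT; have := ord 2 1 isT isT.
move: sP; rewrite !inE => /or3P[] /eqP -> /= /esym zy /esym zx /esym yx
  /esym yz /esym xz /esym xy.
- by exists [:: x; y; z]; rewrite /= ?xy ?yz.
- exists [:: x; z; y]; rewrite /= ?xz ?zy //.
  exact/rst_step/(@WStep123 [::] [::]).
- exists [:: y; z; x]; rewrite /= ?yz ?zx //.
  apply: (@weq_trans [:: y; x; z]).
    exact/rst_step/(@WStep123 [::] [::]).
  exact/rst_step/(@WStep132 [::] [::]).
Qed.

Lemma replacement_step_weq n (phi psi : 'S_n) :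
  replacement_step K_123_132_312 phi psi -> weq (one_line phi) (one_line psi).
Proof.
case=> a [b [u [v [Ephi Epsi su sv]]]] [B BK [s [t [sB tB us vt]]]].
have puv : perm_eq u v.
  have := perm_one_line psi; rewrite perm_sym => /(perm_trans (perm_one_line phi)).
  by rewrite Ephi Epsi perm_cat2l perm_cat2r.
have uu : uniq u.
  have : uniq (one_line phi) by rewrite (perm_uniq (perm_one_line phi)) iota_uniq.
  by rewrite Ephi !cat_uniq => /and3P[_ _ /and3P[]].
rewrite Ephi Epsi; apply: weq_cat.
move: BK; rewrite /K_123_132_312 /add_singletons in_setU => /orP[].
  rewrite in_set1 => /eqP EB; move: sB tB; rewrite {}EB !in_set => sP tP.
  have [u' su' uu'] := order_perm_weq us sP.
  have [v' sv' vv'] := order_perm_weq vt tP.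
  suff Euv : u' = v' by rewrite Euv in uu'; exact: weq_trans (weq_sym uu') vv'.
  apply: (irr_sorted_eq ltn_trans ltnn su' sv') => c.
  by rewrite (perm_mem (weq_perm uu')) (perm_mem (weq_perm vv')) (perm_mem puv).
case/imsetP => q _ EB; move: sB tB us vt; rewrite {}EB !inE => /eqP-> /eqP->.
move=> /is_order_permE[_ ordu] /is_order_permE[_ ordv].
have ord i j : i < 3 -> j < 3 -> (nth 0 u i < nth 0 u j) = (nth 0 v i < nth 0 v j).
  by move=> i3 j3; rewrite -ordu // -ordv.
have [x [y [z Eu]]] := size3 su; have [x' [y' [z' Ev]]] := size3 sv.
move: uu puv ord; rewrite {}Eu {}Ev => uu puv ord.
have -> // : [:: x; y; z] = [:: x'; y'; z'].
apply: order_iso_eq3 => //; [exact: (ord 0 1)|exact: (ord 0 2)|exact: (ord 1 2)].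
Qed.

Lemma pattern_order_perm x y z (p : seq nat) :
    p \in sorting_patterns ->
    (forall i j, i < 3 -> j < 3 ->
      (nth 0 p i < nth 0 p j) = (nth 0 [:: x; y; z] i < nth 0 [:: x; y; z] j)) ->
  exists2 s : 'S_3, s \in perms_of_words 3 sorting_patterns &
    is_order_perm [:: x; y; z] s.
Proof.
move=> pP ord; have [|s sp] := @one_line_surj 3 p.
  by move: pP; rewrite !inE => /or3P[] /eqP->.
exists s; first by rewrite inE sp.
by apply/is_order_permE; split=> //; rewrite sp.
Qed.

Lemma wstep_replacement n (w w' : seq nat) :
    wstep w w' -> perm_eq w (iota 1 n) ->
  replacement_step K_123_132_312 (perm_of_word n w) (perm_of_word n w').
Proof.
move=> st pw.
have pw' : perm_eq w' (iota 1 n).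
  by apply: perm_trans pw; rewrite perm_sym; exact: wstep_perm.
have main a b x y z x' y' z' : w = a ++ [:: x; y; z] ++ b ->
    w' = a ++ [:: x'; y'; z'] ++ b ->
    (exists2 s : 'S_3, s \in perms_of_words 3 sorting_patterns &
      is_order_perm [:: x; y; z] s) ->
    (exists2 s : 'S_3, s \in perms_of_words 3 sorting_patterns &
      is_order_perm [:: x'; y'; z'] s) ->
    replacement_step K_123_132_312 (perm_of_word n w) (perm_of_word n w').
  move=> Ew Ew' [s sP us] [t tP vt].
  exists a, b, [:: x; y; z], [:: x'; y'; z']; rewrite !perm_of_wordK //.
  split=> //; exists (perms_of_words 3 sorting_patterns); last by exists s, t.
  by rewrite /K_123_132_312 /add_singletons in_setU in_set1 eqxx.
case: st main => a b x y z xy yz main; apply: (main a b) => //.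
- apply: (@pattern_order_perm _ _ _ [:: 1; 2; 3]) => //.
  by move=> [|[|[|]]] // [|[|[|]]] //= _ _; lia.
- apply: (@pattern_order_perm _ _ _ [:: 1; 3; 2]) => //.
  by move=> [|[|[|]]] // [|[|[|]]] //= _ _; lia.
- apply: (@pattern_order_perm _ _ _ [:: 1; 3; 2]) => //.
  by move=> [|[|[|]]] // [|[|[|]]] //= _ _; lia.
- apply: (@pattern_order_perm _ _ _ [:: 3; 1; 2]) => //.
  by move=> [|[|[|]]] // [|[|[|]]] //= _ _; lia.
Qed.

(** K-equivalence of permutations is equivalence of their one-line words. *)
Lemma K_equivP n (phi psi : 'S_n) :
  K_equiv K_123_132_312 phi psi <-> weq (one_line phi) (one_line psi).
Proof.
split=> [|phipsi].
  elim=> {phi psi} [phi psi|phi|phi psi _|phi psi chi _ h1 _ h2].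
  - exact: replacement_step_weq.
  - exact: weq_refl.
  - exact: weq_sym.
  - exact: weq_trans h1 h2.
rewrite -(one_lineK phi) -(one_lineK psi).
apply: (@weq_transport _ (@K_equiv 3 K_123_132_312 n) (@perm_of_word n)
  (fun w => perm_eq w (iota 1 n))) phipsi (perm_one_line phi).
- by move=> u; exact: rst_refl.
- by move=> u v; exact: rst_sym.
- by move=> u v w; exact: rst_trans.
- by move=> w w' /wstep_perm p; rewrite (permPl p).
- by move=> w w' st pw; exact/rst_step/wstep_replacement.
Qed.

(** * Counting the classes *)

(** A family p meeting each class of E exactly once has as many members as there
    are classes. *)
Lemma card_equivalence_partition (T : finType) (E : rel T) (N : nat)
    (p : 'I_N -> T) :
    equivalence_rel E -> (forall x, exists i, E (p i) x) ->
    (forall i j, E (p i) (p j) -> i = j) ->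
  #|equivalence_partition E [set: T]| = N.
Proof.
move=> eqE exE injE; pose C x := [set y in [set: T] | E x y].
have CE x y : E x y -> C x = C y.
  by move=> xy; apply/setP => z; rewrite !inE /=; case: (eqE x y z) => _ /(_ xy).
have -> : equivalence_partition E [set: T] = [set C (p i) | i : 'I_N].
  apply/setP => B; apply/imsetP/imsetP => [[x _ ->]|[i _ ->]].
    by have [i ix] := exE x; exists i; rewrite // (CE _ _ ix).
  by exists (p i).
rewrite card_imset ?card_ord // => i j /setP/(_ (p j)).
rewrite !inE /= => Eij; apply: injE; rewrite Eij.
by case: (eqE (p j) (p j) (p j)).
Qed.

Lemma num_classes_count n : num_classes K_123_132_312 n = class_count n.
Proof.
have iota_sorted : sorted ltn (iota 1 n) by exact: iota_ltn_sorted.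
have szn : size (iota 1 n) <= n by rewrite size_iota.
have [Rp Rex Rinj Runiq] := reps_transversal szn iota_sorted.
have := size_reps szn; rewrite [in RHS]size_iota => <-.
set R := reps _ _ in Rp Rex Rinj Runiq *.
have Rn i : i < size R -> perm_eq (nth [::] R i) (iota 1 n).
  by move=> iR; apply: Rp; rewrite mem_nth.
apply: (@card_equivalence_partition _ _ _ (fun i : 'I_(size R) => perm_of_word n (nth [::] R i))).
- move=> x y z; split; first by apply/asboolP/rst_refl.
  move=> /asboolP xy; apply/asboolP/asboolP => [xz|yz].
    by apply: rst_trans xz; exact: rst_sym.
  exact: rst_trans yz.
- move=> x; have [r rR xr] := Rex _ (perm_one_line x).
  have ir : index r R < size R by rewrite index_mem.
  exists (Ordinal ir); apply/asboolP/K_equivP.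
  by rewrite /= nth_index // perm_of_wordK ?Rp //; exact: weq_sym.
- move=> i j /asboolP/K_equivP; rewrite !perm_of_wordK ?Rn //.
  move/Rinj; rewrite !mem_nth // => /(_ isT isT) /eqP.
  by rewrite nth_uniq // => /eqP /val_inj.
Qed.

Theorem theorem2p23 :
  let f := num_classes K_123_132_312 in
  [/\ f 3 = 4,
      f 4 = 9
    & forall n : nat, 5 <= n -> f n = f (n - 1) + (n - 2) * f (n - 2) + 1].
Proof.
move=> f; rewrite /f; split; rewrite ?num_classes_count //.
by case=> [|[|n]] // _; rewrite !num_classes_count subn1 subn2 class_countE.
Qed.
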